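(* For every prime $p\ge 5$, $$\sum_{j=0}^{p}T(p,j)\equiv \frac{1}{2}\left(1+3^p\right)\pmod{p^2},$$ and $$\sum_{j=0}^{p-1}T(p-1,j)\equiv \frac{1}{2}\left(1+\left(\frac{p}{3}\right)\right)\pmod{p}.$$
   Context: For an integer $n\ge 0$ and an integer $j$, the trinomial coefficient $T(n,j)$ is the coefficient of $x^j$ in the Laurent polynomial $(1+x+x^{-1})^n$, i.e. $(1+x+x^{-1})^n=\sum_{j=-n}^{n}T(n,j)x^j$ (and $T(n,j)=0$ for $|j|>n$). Here $\left(\frac{p}{3}\right)$ denotes the Legendre symbol, equal to $1$ if $p\equiv 1\pmod 3$ and $-1$ if $p\equiv 2\pmod 3$. Congruences between rationals are understood in the ring of rationals with denominators prime to $p$. *)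

(* Defs.v *)
From HB Require Import structures.
From mathcomp Require Import all_boot all_order all_algebra.

Set Implicit Arguments.
Unset Strict Implicit.
Unset Printing Implicit Defensive.

Import Order.TTheory GRing.Theory Num.Theory.
Local Open Scope ring_scope.

Local Notation "p %:F" := (FracField.tofrac p) : ring_scope.

(* Laurent polynomials over int are handled inside the field of fractions of  *)
(* {poly int}, where lx is the (invertible) indeterminate.                    *)
Definition lx : {fraction {poly int}} := 'X%:F.

(* The index i of the sum stands for the exponent j = i - n in [-n, n].       *)
Definition trinomial_expansion (n : nat) (c : int -> int) : Prop :=
  (1 + lx + lx^-1) ^+ n
    = \sum_(i < n.*2.+1) (c (i%:Z - n%:Z))%:~R * lx ^ (i%:Z - n%:Z)
  /\ (forall j : int, n%:Z < `|j| -> c j = 0).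

Lemma lx_neq0 : lx != 0.
Proof. by rewrite tofrac_eq0 polyX_eq0. Qed.

Lemma expansion_shift n (c : int -> int) :
  (\sum_(i < n.*2.+1) (c (i%:Z - n%:Z))%:~R * lx ^ (i%:Z - n%:Z)) * lx ^+ n
    = (\poly_(i < n.*2.+1) c (i%:Z - n%:Z))%:F.
Proof.
rewrite poly_def raddf_sum mulr_suml; apply: eq_bigr => i _ /=.
have -> : lx ^+ n = lx ^ n%:Z by [].
rewrite -mulrA -expfzDr ?lx_neq0 // subrK.
rewrite -mul_polyC rmorphM rmorphXn /= -[in RHS](intz (c _)).
by rewrite !rmorph_int.
Qed.

Lemma trinomial_shift n :
  (1 + lx + lx^-1) ^+ n * lx ^+ n = ((1 + 'X + 'X^2) ^+ n : {poly int})%:F.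
Proof.
rewrite -exprMn !mulrDl mulVf ?lx_neq0 // mul1r -expr2.
by rewrite rmorphXn !rmorphD /= rmorph1 rmorphXn /= addrC addrA.
Qed.

Lemma trinomial_expansion_sig (n : nat) :
  {c : int -> int | trinomial_expansion n c}.
Proof.
pose P : {poly int} := (1 + 'X + 'X^2) ^+ n.
pose c (j : int) : int := if `|j| <= n%:Z then P`_(absz (j + n%:Z)) else 0.
exists c.
split; last by move=> j; rewrite /c ltNge => /negPf->.
apply: (mulIf (expf_neq0 n lx_neq0)); rewrite trinomial_shift expansion_shift -/P.
congr (_%:F); apply/polyP=> i; rewrite coef_poly /c subrK.
have szP : (size P <= n.*2.+1)%N.
  apply: leq_trans (size_poly_exp_leq _ _) _.
  have : (size (1 + 'X + 'X^2 : {poly int})%R <= 3)%N.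
    apply: leq_trans (size_polyD _ _) _; rewrite size_polyXn geq_max andbT.
    by apply: leq_trans (size_polyD _ _) _; rewrite size_polyX size_poly1.
  rewrite ltnS -muln2 mulnC => h; rewrite leq_mul2l; apply/orP; right.
  by case: (size _) h.
case: ltnP => [lt_i|le_i]; last by rewrite nth_default // (leq_trans szP).
rewrite ifT ?absz_nat // ler_norml lerBlDr lerBrDr addNr.
by rewrite -PoszD !lez_nat addnn -(ltnS i).
Qed.

Lemma trinomial_expansion_unique (n : nat) (c d : int -> int) :
  trinomial_expansion n c -> trinomial_expansion n d -> c =1 d.
Proof.
move=> [ec c0] [ed d0] j.
case: (ltP n%:Z `|j|) => [lt_nj|]; first by rewrite c0 ?d0.
rewrite ler_norml => /andP[lo hi].
have /eqP : (\poly_(i < n.*2.+1) c (i%:Z - n%:Z))%:F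
         = (\poly_(i < n.*2.+1) d (i%:Z - n%:Z))%:F.
  by rewrite -!expansion_shift -ec -ed.
rewrite tofrac_eq => /eqP /polyP /(_ (absz (j + n%:Z))).
have jn : (absz (j + n%:Z) : int) = j + n%:Z.
  by rewrite gez0_abs // -lerBlDr sub0r.
rewrite !coef_poly jn addrK.
have -> // : (absz (j + n%:Z)%R < n.*2.+1)%N.
by rewrite ltnS -lez_nat jn -addnn PoszD lerD2r.
Qed.

Definition trinomial (n : nat) (j : int) : int :=
  sval (trinomial_expansion_sig n) j.

Lemma trinomialP (n : nat) : trinomial_expansion n (trinomial n).
Proof. exact: (svalP (trinomial_expansion_sig n)). Qed.

Definition legendre (a q : nat) : int :=
  if (q %| a)%N then 0
  else if [exists x : 'I_q, (x ^ 2 == a %[mod q])%N] then 1 else -1.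

Lemma legendre3_1 (a : nat) : (a %% 3 = 1)%N -> legendre a 3 = 1.
Proof.
move=> a1; rewrite /legendre /dvdn a1 /= ifT //.
by apply/existsP; exists (inord 1); rewrite inordK // a1.
Qed.

Lemma legendre3_2 (a : nat) : (a %% 3 = 2)%N -> legendre a 3 = -1.
Proof.
move=> a2; rewrite /legendre /dvdn a2 /= ifF //.
by apply/existsP=> -[[[|[|[|x]]] hx]] //; rewrite a2.
Qed.

(* The ring of rationals whose denominator is prime to p.                     *)
Definition Zloc (p : nat) : {pred rat} := [pred x | coprime p `|denq x|].

Definition eqZloc (p : nat) (m a b : rat) : Prop :=
  [/\ a \in Zloc p, b \in Zloc p & exists2 c, c \in Zloc p & a - b = m * c].

(* Main.v *)
(* With f = 1 + x + x^2, T(n, j) is the coefficient of x^(n+j) in f^n. As f^n is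
   palindromic, twice the sum of the T(n, j) over j >= 0 is f(1)^n + T(n, 0), so
   it remains to find T(p, 0) mod p^2 and T(p-1, 0) mod p.
   - In f^p (1 - x)^p = (1 - x^3)^p the coefficient of x^p is 0 on the right,
     since p is not divisible by 3. On the left, by Frobenius, the coefficients
     of x^i for 0 < i < p are divisible by p in both factors, so only the extreme
     terms T(p, 0) - 1 survive modulo p^2.
   - Over F_p, f^(p-1) (1 - x^3) = (1 - x) f^p = (1 - x) (1 + x^p + x^(2p)), so
     below degree p the coefficients of f^(p-1) are 1, -1, 0 periodically. *)
Require Import Defs.
From HB Require Import structures.
From mathcomp Require Import all_boot all_order all_algebra.
From mathcomp Require Import zify ring.
Import Order.TTheory GRing.Theory Num.Theory.
Local Open Scope ring_scope.

Lemma dvdz_pchar (R : nzRingType) (p : nat) (a : int) :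
  p \in [pchar R] -> (p %| a)%Z = (a%:~R == 0 :> R).
Proof.
move=> pR; case: a => n; rewrite dvdzE /= (dvdn_pcharf pR) //.
by rewrite NegzE rmorphN oppr_eq0.
Qed.

Lemma exprDp_poly (p : nat) (pr : prime p) (a b : {poly 'F_p}) :
  (a + b) ^+ p = a ^+ p + b ^+ p.
Proof.
apply: exprDn_pchar; rewrite pnatE //.
by rewrite pchar_poly pchar_Fp.
Qed.

(** The ring is a parameter because the same powers are studied over [int] and, after reduction,
    over ['F_p]. *)
Definition trinom (R : nzRingType) : {poly R} := 1 + 'X + 'X^2.

Lemma map_trinom (R S : nzRingType) (h : {rmorphism R -> S}) n :
  map_poly h (trinom R ^+ n) = trinom S ^+ n.
Proof. by rewrite rmorphXn !rmorphD /= rmorph1 map_polyX map_polyXn. Qed.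

Lemma mul_trinom (R : comNzRingType) : trinom R * (1 - 'X) = 1 - 'X^3.
Proof. by rewrite /trinom; ring. Qed.

Lemma trinom_Fp (p : nat) : prime p -> trinom 'F_p ^+ p = 1 + 'X^p + 'X^(p.*2).
Proof.
by move=> pr; rewrite !exprDp_poly // expr1n -exprM mulnC muln2.
Qed.

Lemma coef_trinomS (R : nzRingType) n i :
  (trinom R ^+ n.+1)`_i.+2 =
  (trinom R ^+ n)`_i.+2 + (trinom R ^+ n)`_i.+1 + (trinom R ^+ n)`_i.
Proof.
by rewrite exprSr !mulrDr mulr1 !coefD coefMX coefMXn /= subn2.
Qed.

Lemma size_trinom (R : nzRingType) n : (size (trinom R ^+ n) <= n.*2.+1)%N.
Proof.
have szT : (size (trinom R) <= 3)%N.
  rewrite /trinom -[1]/(1%:P) -{1}['X]expr1.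
  apply: leq_trans (size_polyD _ _) _; rewrite size_polyXn geq_max andbT.
  by apply: leq_trans (size_polyD _ _) _; rewrite size_polyXn size_polyC oner_eq0.
apply: leq_trans (size_poly_exp_leq _ _) _; move: szT; nia.
Qed.

Lemma coef_trinom_default (R : nzRingType) n i : (n.*2 < i)%N -> (trinom R ^+ n)`_i = 0.
Proof. by move=> lt_ni; apply/nth_default/(leq_trans (size_trinom R n)). Qed.

(** Induction on [n]: reflection permutes the three terms of the recurrence [coef_trinomS]. That
    recurrence starts at index 2, so indices 0 and 1 are treated apart. *)
Lemma coef_trinom_sym (R : nzRingType) n i j :
  (i + j = n.*2)%N -> (trinom R ^+ n)`_i = (trinom R ^+ n)`_j.
Proof.
elim: n i j => [|n IHn] i j hs.
  by have [-> ->] : i = 0%N /\ j = 0%N by lia.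
wlog le_ij : i j hs / (i <= j)%N => [W|].
  by case: (leqP i j) => [|/ltnW] hij; [|symmetry]; apply: W => //; rewrite addnC.
case: i => [|[|i]] in hs le_ij *.
- have -> : j = n.*2.+2 by lia.
  rewrite coef_trinomS (@coef_trinom_default _ n n.*2.+1) ?(@coef_trinom_default _ n n.*2.+2) //.
  rewrite !add0r -(IHn 0%N n.*2) //.
  by rewrite exprSr !mulrDr mulr1 !coefD coefMX coefMXn /= !addr0.
- have -> : j = n.*2.+1 by lia.
  case: n => [|n] in IHn hs *.
    by rewrite !expr1 /trinom !coefD !coefX !coefXn !coef1 /= addr0 add0r.
  rewrite doubleS coef_trinomS (nth_default _ (size_trinom R _)).
  rewrite add0r -(IHn 0%N n.*2.+2) -?(IHn 1%N n.*2.+1) //; try lia.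
  by rewrite [in LHS]exprSr !mulrDr mulr1 !coefD coefMX coefMXn /= addr0 addrC.
case: j => [|[|j]] in hs le_ij *; try by exfalso; lia.
rewrite !coef_trinomS.
rewrite (IHn i j.+2) ?(IHn i.+1 j.+1) ?(IHn i.+2 j); try lia.
by rewrite addrC [X in _ + X]addrC addrA.
Qed.

Lemma trinomialE n (j : nat) : trinomial n j%:Z = (trinom int ^+ n)`_(n + j).
Proof.
case: (trinomialP n) => e c0.
have [lt_nj|le_jn] := ltnP n j.
  rewrite c0 ?nth_default // (leq_trans (size_trinom _ n)) //; lia.
have := trinomial_shift n; rewrite e expansion_shift => /eqP.
rewrite tofrac_eq => /eqP/polyP/(_ (n + j)%N).
rewrite coef_poly ifT; last by lia.
by rewrite PoszD addrC addKr.
Qed.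

Lemma sum_trinomial n :
  2 * (\sum_(0 <= j < n.+1) trinomial n j%:Z) = 3 ^+ n + trinomial n 0.
Proof.
have h1 : (trinom int ^+ n).[1] = 3 ^+ n.
  by rewrite horner_exp /trinom !hornerD hornerXn hornerX hornerC expr1n.
have h2 : (trinom int ^+ n).[1] = \sum_(0 <= i < n + n.+1) (trinom int ^+ n)`_i.
  rewrite (@horner_coef_wide _ (n + n.+1)) ?big_mkord.
    by apply: eq_bigr => i _; rewrite expr1n mulr1.
  by rewrite (leq_trans (size_trinom _ n)) //; lia.
rewrite -h1 h2 [in RHS](@big_cat_nat _ _ _ n) ?leq_addr //=.
have -> : \sum_(n <= i < n + n.+1) (trinom int ^+ n)`_i
   = \sum_(0 <= j < n.+1) trinomial n j%:Z.
  rewrite -[X in \sum_(X <= _ < _) _]add0n big_addn addKn; apply: eq_bigr => j _.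
  by rewrite trinomialE addnC.
(* Reflection about the middle index [n]; the central term stays in the other half only, hence the
   extra [trinomial n 0]. *)
have -> : \sum_(0 <= i < n) (trinom int ^+ n)`_i = \sum_(1 <= j < n.+1) trinomial n j%:Z.
  rewrite big_nat_rev big_add1 /= !big_nat; apply: eq_bigr => j hj.
  by rewrite trinomialE; apply: coef_trinom_sym; lia.
by rewrite big_ltn //; ring.
Qed.

(** Each inner term of the convolution is a product of two multiples of [p]. *)
Lemma dvd_coefM (p : nat) (a b : {poly int}) : (0 < p)%N ->
  (forall i, (0 < i < p)%N -> (p %| a`_i)%Z) ->
  (forall i, (0 < i < p)%N -> (p %| b`_i)%Z) ->
  ((p ^ 2)%N %| (a * b)`_p - (a`_0 * b`_p + a`_p * b`_0))%Z.
Proof.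
move=> p0 ha hb; rewrite coefM.
case: p p0 ha hb => // p _ ha hb.
rewrite big_ord_recl big_ord_recr /= subn0 subnn.
rewrite addrA addrAC [X in X - _]addrC addrK.
apply: rpred_sum => i _; rewrite /= PoszM; apply: dvdz_mul.
  by apply: ha; rewrite /= /bump; have := ltn_ord i; lia.
by apply: hb; rewrite /= /bump; have := ltn_ord i; lia.
Qed.

Lemma dvd_coef_trinom (p i : nat) : prime p -> (0 < i < p)%N ->
  (p %| (trinom int ^+ p)`_i)%Z.
Proof.
move=> pr hi; rewrite (dvdz_pchar _ _ _ (pchar_Fp pr)) -coef_map map_trinom trinom_Fp //.
rewrite !coefD coef1 !coefXn (@gtn_eqF 0 i) ?(@ltn_eqF i) ?addr0 // -?muln2; lia.
Qed.

Lemma dvd_trinomial_prime (p : nat) : prime p -> (5 <= p)%N ->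
  ((p ^ 2)%N %| trinomial p 0 - 1)%Z.
Proof.
move=> pr p5; rewrite (trinomialE p 0) addn0.
pose b : {poly int} := (1 - 'X) ^+ p.
have p_odd : odd p by case: (even_prime pr) => [?|//]; lia.
have b0 : b`_0 = 1.
  by rewrite -horner_coef0 horner_exp !hornerE expr1n.
have bp : b`_p = -1.
  have -> : b = - ('X - 1%:P) ^+ p by rewrite /b -opprB exprNn -signr_odd p_odd expr1 mulN1r.
  rewrite coefN; congr (- _).
  have /monicP : ('X - 1%:P : {poly int}) ^+ p \is monic by rewrite monic_exp ?monicXsubC.
  by rewrite lead_coefE size_exp_XsubC.
have a0 : (trinom int ^+ p)`_0 = 1.
  by rewrite -horner_coef0 horner_exp !hornerE expr1n.
have := @dvd_coefM p (trinom int ^+ p) b (prime_gt0 pr) _ _.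
rewrite -exprMn mul_trinom b0 bp a0.
(* A polynomial in ['X^3] has no term of degree [p], as 3 does not divide [p]. *)
have -> : (1 - 'X^3 : {poly int}) ^+ p = b \Po 'X^3.
  by rewrite /b rmorphXn rmorphB rmorph1 /= comp_polyX.
rewrite coef_comp_poly_Xn // dvdn_prime2 // ifF; last by lia.
rewrite mul1r mulr1 sub0r rpredN addrC => -> // i hi.
  exact: dvd_coef_trinom.
rewrite (dvdz_pchar _ _ _ (pchar_Fp pr)) -coef_map /b rmorphXn rmorphB rmorph1 /= map_polyX.
rewrite exprDp_poly // expr1n coefD coef1 exprNn -signr_odd p_odd mulN1r coefN coefXn.
by rewrite (@gtn_eqF 0 i) ?(@ltn_eqF i) ?subrr ?eqxx //; lia.
Qed.

(** Below degree [p] the right side is just [1 - 'X], so comparing coefficients gives the initial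
    values 1, -1, 0 and then period 3. *)
Lemma coef_quotient_1subX3 (R : comNzRingType) (p : nat) (g : {poly R}) : (1 < p)%N ->
  g * (1 - 'X^3) = (1 - 'X) * (1 + 'X^p + 'X^(p.*2)) ->
  forall i, (i < p)%N -> g`_i = (i %% 3 == 0)%N%:R - (i %% 3 == 1)%N%:R.
Proof.
move=> p1 e; elim/ltn_ind => i IH hi.
move/polyP/(_ i): e.
rewrite mulrBr mulr1 coefB coefMXn mulrBl mul1r coefB coefXM !coefD !coef1 !coefXn.
rewrite (@ltn_eqF i p) ?(@ltn_eqF i p.*2) ?(@ltn_eqF i.-1 p)
  ?(@ltn_eqF i.-1 p.*2); try lia.
rewrite !addr0.
case: ltnP => h3.
  rewrite subr0 => ->; case: i h3 {IH hi} => [|[|[|]]] //=; rewrite ?subr0 ?sub0r ?subrr //.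
rewrite (IH (i - 3)%N) //; try lia.
have <- : (i %% 3 = (i - 3) %% 3)%N by lia.
case: i h3 {IH hi} => [|[|i]] //= _ /eqP.
by rewrite subr0 subr_eq0 => /eqP.
Qed.

Lemma dvd_trinomial_pred (p : nat) : prime p -> (5 <= p)%N ->
  (p %| trinomial p.-1 0 - legendre p 3)%Z.
Proof.
move=> pr p5; rewrite (trinomialE _ 0) addn0.
rewrite (dvdz_pchar _ _ _ (pchar_Fp pr)) rmorphB /= -coef_map map_trinom.
rewrite (@coef_quotient_1subX3 _ p) //; try lia; last first.
  rewrite -mul_trinom mulrA -exprSr prednK ?prime_gt0 // trinom_Fp //.
  by rewrite mulrC.
have : (p %% 3 != 0)%N.
  by rewrite -[X in X != _]/(p %% 3)%N -[_ == _]/(3 %| p)%N dvdn_prime2 //; lia.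
(* The central index is [p.-1]: its residue 0 or 1 modulo 3 gives the coefficient 1 or -1, which is
   the Legendre symbol. *)
move=> p3; have [[m1 m2]|[m1 m2]] :
    (p %% 3 = 1 /\ p.-1 %% 3 = 0 \/ p %% 3 = 2 /\ p.-1 %% 3 = 1)%N by lia.
  by rewrite legendre3_1 // m2 subr0 subrr.
by rewrite legendre3_2 // m2 sub0r rmorphN subrr.
Qed.

Lemma half_Zloc (p : nat) (a : int) : odd p -> 2^-1 * a%:~R \in Zloc p.
Proof.
move=> p_odd; rewrite inE; set x := _ * _.
(* Hence the denominator of [x] divides twice the numerator; being coprime to the numerator, it
   divides 2. *)
have e : 2 * numq x = a * denq x.
  apply: (@intr_inj rat); rewrite !rmorphM /=.
  have -> : (numq x)%:~R = x * (denq x)%:~R :> rat by rewrite numqE.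
  by rewrite /x; field.
have : (`|denq x| %| 2 * `|numq x|)%N.
  by rewrite -(abszM 2) e abszM dvdn_mull.
rewrite Gauss_dvdl; last by rewrite coprime_sym coprime_num_den.
move=> d2; rewrite coprime_sym (coprime_dvdl d2) //.
by rewrite coprime2n.
Qed.

(** For odd [p], 2 is invertible in [Zloc p], so the congruence may be checked on integers after
    doubling. *)
Lemma eqZloc_half (p : nat) (m S a : int) : odd p ->
  (m %| 2 * S - a)%Z -> eqZloc p m%:~R S%:~R (2^-1 * a%:~R).
Proof.
move=> p_odd /dvdzP [q e]; split.
- by rewrite inE denq_int /coprime gcdn1.
- exact: half_Zloc.
exists (2^-1 * q%:~R); first exact: half_Zloc.
have : (2 * S - a)%:~R = (q * m)%:~R :> rat by rewrite e.
rewrite rmorphB !rmorphM /= => {}e.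
have -> : m%:~R * (2^-1 * q%:~R) = 2^-1 * (q%:~R * m%:~R) :> rat by ring.
by rewrite -e; field.
Qed.

Theorem theorem2 (p : nat) (p_prime : prime p) (p_ge5 : (5 <= p)%N) :
  eqZloc p (p%:R ^+ 2)
    (\sum_(0 <= j < p.+1) trinomial p j%:Z)%:~R
    (2^-1 * (1 + 3 ^+ p))
  /\
  eqZloc p p%:R
    (\sum_(0 <= j < p) trinomial p.-1 j%:Z)%:~R
    (2^-1 * (1 + (legendre p 3)%:~R)).
Proof.
have p_odd : odd p by case: (even_prime p_prime) => [?|//]; lia.
split.
  have -> : p%:R ^+ 2 = (p ^ 2)%N%:~R :> rat by rewrite -natrX.
  have -> : 1 + 3 ^+ p = (1 + 3 ^+ p)%:~R :> rat by rewrite rmorphD rmorphXn.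
  apply: eqZloc_half => //; rewrite sum_trinomial.
  by rewrite (addrC 1) opprD addrACA subrr add0r dvd_trinomial_prime.
have -> : 1 + (legendre p 3)%:~R = (1 + legendre p 3)%:~R :> rat by rewrite rmorphD.
apply: (@eqZloc_half p p) => //.
have := sum_trinomial p.-1; rewrite prednK ?prime_gt0 // => ->.
rewrite opprD addrACA rpredD ?dvd_trinomial_pred //.
(* What is left is Fermat's [3 ^+ p.-1 = 1] in ['F_p]: Frobenius fixes 3, and 3 cancels since [p]
   exceeds 3. *)
rewrite (dvdz_pchar _ _ _ (pchar_Fp p_prime)) rmorphB rmorphXn /= subr_eq0.
have p3 : (3 : 'F_p) != 0.
  rewrite -(dvdn_pcharf (pchar_Fp p_prime)) gtnNdvd //; lia.
apply/eqP/(mulfI p3); rewrite -exprS prednK ?prime_gt0 // mulr1.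
by rewrite -(pFrobenius_autE (pchar_Fp p_prime)) rmorph_nat.
Qed.
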